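(* For every $\mathrm{CSP}_p$ context $C[\cdot]$, all $\mathrm{CSP}_p$ processes $\{x_i\}_{i\in I}$ and probabilities $\pi_i\in(0,1]$ with $\sum_{i\in I}\pi_i=1$, it holds that $$C\Bigl[\bigoplus_{i\in I}\pi_ix_i\Bigr]\ \approx_{\mathcal{O}}\ \bigoplus_{i\in I}\pi_iC[x_i].$$
   Context: Fix a finite set of actions $\mathcal{A}$. A probabilistic transition system (PTS) is a tuple $(S_n,S_p,\rightarrow,\dashrightarrow)$ where $S_n,S_p$ are finite disjoint sets of nondeterministic and probabilistic states; $\rightarrow\ \subseteq S_n\times\mathcal{A}\times(S_n\cup S_p)$ is an action transition relation such that $(s,a,t),(s,a,t')\in\rightarrow$ implies $t=t'$; and $\dashrightarrow\ \subseteq S_p\times(0,1]\times S_n$ is a probabilistic transition relation with $\sum_{(s,\pi,t)\in\dashrightarrow}\pi=1$ for every $s\in S_p$. A state with no outgoing transitions belongs to $S_n$. Write $s\xrightarrow{a}t$ and $s\overset{\pi}{\dashrightarrow}t$. A process is a state together with all states reachable from it and the transitions between them. For $s\in S_n$, its menu is $I(s)=\{a\in\mathcal{A}: s\xrightarrow{a}t \text{ for some } t\}$. Given a process $s$, a set $M\subseteq\mathcal{A}$ and $a\in M$ such that $I(s)=M$ if $s\in S_n$, or otherwise there is $s\overset{}{\dashrightarrow}s'$ with $I(s')=M$, the process $s_{(M,a)}$ is defined as follows: if $s\in S_n$, its root is the state $s'$ with $s\xrightarrow{a}s'$; if $s\in S_p$, a new root state is created; let $\pi=\sum\{\pi_i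 : s\overset{\pi_i}{\dashrightarrow}s_i,\ I(s_i)=M\}$; for every $s_i'$ with $s\overset{\pi_i}{\dashrightarrow}s_i\xrightarrow{a}s_i'$ and $I(s_i)=M$: if $s_i'$ has no probabilistic transitions, add an edge from the new root to $s_i'$ with probability $\pi_i/\pi$; and for every $s_i'\overset{\rho}{\dashrightarrow}s_i''$, add an edge from the new root to $s_i''$ with probability $\pi_i\rho/\pi$. A ready trace of length $n$ is a sequence $(M_1,a_1,M_2,\dots,M_{n-1},a_{n-1},M_n)$ with $M_i\subseteq\mathcal{A}$ and $a_i\in M_i$. For a process $s$ and $M\subseteq\mathcal{A}$: $P^1_s(M)=\sum_{s\overset{\pi}{\dashrightarrow}s'}\pi\cdot P^1_{s'}(M)$ if $s\in S_p$; $P^1_s(M)=1$ if $s\in S_n$ and $I(s)=M$; $P^1_s(M)=0$ otherwise. For $n>1$: if $P^1_s(M_1)>0$ then $P^2_s(M_2\mid M_1,a_1)=P^1_{s_{(M_1,a_1)}}(M_2)$ and, for $n>2$, $P^n_s(M_n\mid M_1,a_1,\dots,M_{n-1},a_{n-1})=P^{n-1}_{s_{(M_1,a_1)}}(M_n\mid M_2,a_2,\dots,M_{n-1},a_{n-1})$; if $P^1_s(M_1)=0$ these are undefined. Two processes $s,\bar s$ are probabilistically ready trace equivalent, $s\approx_{\mathcal{O}}\bar s$, iff $P^1_s(M)=P^1_{\bar s}(M)$ for all $M\subseteq\mathcal{A}$, and for every $n>1$ and every ready trace, $P^n_s(M_n\mid M_1,a_1,\dots,a_{n-1})$ is defined iff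 $P^n_{\bar s}(M_n\mid M_1,a_1,\dots,a_{n-1})$ is defined, and then they are equal. $\mathrm{CSP}_p$ processes are generated by $P ::= \delta \mid \sum_{i\in I}a_i.P_i \mid \bigoplus_{i\in I}\pi_iP_i \mid \Theta P \mid P\parallel P \mid P\parallel_L P$, where $\{a_i\}_{i\in I}\subseteq\mathcal{A}$ are pairwise distinct, $\pi_i\in(0,1]$ with $\sum_i\pi_i=1$, and in $P\parallel_L P$ the set $L\subseteq\mathcal{A}$ is the set of actions appearing in both operands (and it is required that if $p,q$ share actions and $q,r$ share actions then $p,r$ share none). $\delta$ has no transitions; $a.p$ is a one-summand external choice and $a$ abbreviates $a.\delta$; $\Theta$ is a priority operator w.r.t. a fixed partial order $>$ on $\mathcal{A}$. The semantics is the PTS given by the rules (symmetric rules for $\parallel$ and $\parallel_L$ are included; ''$q\not\dashrightarrow$'' means $q$ has no probabilistic transition): $\sum_{i}a_i.p_i\xrightarrow{a_i}p_i$; if $p\xrightarrow{a}p'$ and $q\xrightarrow{a}q'$ then $p\parallel q\xrightarrow{a}p'\parallel q'$; if $p\overset{\pi}{\dashrightarrow}p'$, $q\overset{\rho}{\dashrightarrow}q'$ then $p\parallel q\overset{\pi\rho}{\dashrightarrow}p'\parallel q'$; if $p\overset{\pi}{\dashrightarrow}p'$, $q\not\dashrightarrow$ then $p\parallel q\overset{\pi}{\dashrightarrow}p'\parallel q$; if $p_k\not\dashrightarrow$ then $\bigoplus_i\pi_ip_i\overset{\pi_k}{\dashrightarrow}p_k$; if $p_k\overset{\rho_k}{\dashrightarrow}p_k'$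 then $\bigoplus_i\pi_ip_i\overset{\pi_k\rho_k}{\dashrightarrow}p_k'$; if $a\notin L$, $p\xrightarrow{a}p'$, $q\not\dashrightarrow$ then $p\parallel_L q\xrightarrow{a}p'\parallel_L q$; if $a\in L$, $p\xrightarrow{a}p'$, $q\xrightarrow{a}q'$ then $p\parallel_L q\xrightarrow{a}p'\parallel_L q'$; if $p\overset{\pi}{\dashrightarrow}p'$, $q\not\dashrightarrow$ then $p\parallel_L q\overset{\pi}{\dashrightarrow}p'\parallel_L q$; if $p\overset{\pi}{\dashrightarrow}p'$, $q\overset{\rho}{\dashrightarrow}q'$ then $p\parallel_L q\overset{\pi\rho}{\dashrightarrow}p'\parallel_L q'$; if $p\xrightarrow{a}p'$ and $p$ has no transition $p\xrightarrow{b}$ with $a<b$ then $\Theta p\xrightarrow{a}\Theta p'$; if $p\overset{\pi}{\dashrightarrow}p'$ then $\Theta p\overset{\pi}{\dashrightarrow}\Theta p'$. A context $C[\cdot]$ is a $\mathrm{CSP}_p$ process with a hole; $C[p]$ is obtained by filling the hole with $p$. *)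

(* Defs.v *)
From HB Require Import structures.
From mathcomp Require Import all_boot all_order all_algebra.
From mathcomp Require Import boolp reals.

Set Implicit Arguments.
Unset Strict Implicit.
Unset Printing Implicit Defensive.

Import Order.TTheory GRing.Theory Num.Theory.
Local Open Scope ring_scope.

Section TransitionSystems.
Variables (R : realType) (A : finType).

(* The laws of a probabilistic transition system are not fields: they are
   required of the reachable part only, by [is_pts] below, so that the terms of
   the process language can serve as states without a subtype.

   [atrans s a] lists the a-successors of s; [ptrans s] lists the probabilistic
   transitions of s as pairs (probability, target).  The latter is a multiset:
   the choice 1/2 p (+) 1/2 p has two transitions of probability 1/2 to p, which
   a set of triples would identify, leaving a total mass of 1/2. *)
Record lts := LTS {
  state :> eqType;
  atrans : state -> A -> seq state;
  ptrans : state -> seq (R * state) }.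

(* S_p is the set of states with a probabilistic transition (a state of S_p has
   outgoing mass 1, hence at least one) and S_n is its complement. *)
Definition probabilistic (T : lts) (s : T) : bool := ~~ nilp (ptrans s).

Definition menu (T : lts) (s : T) : {set A} := [set a | ~~ nilp (atrans s a)].

Record process := Process { sys :> lts; proc_root : sys }.

Inductive reachable (T : lts) (s : T) : T -> Prop :=
| reach_refl : reachable s s
| reach_act t a u : reachable s t -> u \in atrans t a -> reachable s u
| reach_prob t e : reachable s t -> e \in ptrans t -> reachable s e.2.

Record is_pts (p : process) : Prop := {
  pts_finite : exists l : seq p, forall t, reachable (proc_root p) t -> t \in l;
  pts_deterministic : forall t, reachable (proc_root p) t ->
    forall a, (size (atrans t a) <= 1)%N;
  pts_disjoint : forall t, reachable (proc_root p) t ->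
    probabilistic t -> forall a, atrans t a = [::];
  pts_edge : forall t, reachable (proc_root p) t -> forall e, e \in ptrans t ->
    0 < e.1 <= 1 /\ ~~ probabilistic e.2;
  pts_mass : forall t, reachable (proc_root p) t ->
    probabilistic t -> \sum_(e <- ptrans t) e.1 = 1 }.

(* The recursion on probabilistic states has depth one, since the targets of
   probabilistic transitions are nondeterministic. *)
Definition P1 (s : process) (M : {set A}) : R :=
  if probabilistic (proc_root s) then
    \sum_(e <- ptrans (proc_root s)) e.1 * (menu e.2 == M)%:R
  else (menu (proc_root s) == M)%:R.

Definition new_root_ptrans (T : lts) (s : T) (M : {set A}) (a : A) :
    seq (R * T) :=
  let pi := \sum_(e <- ptrans s | menu e.2 == M) e.1 in
  flatten [seq
    flatten [seq
      if nilp (ptrans t) then [:: (e.1 / pi, t)]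
      else [seq (e.1 * f.1 / pi, f.2) | f <- ptrans t]
    | t <- atrans e.2 a]
  | e <- ptrans s & menu e.2 == M].

(* T with a new state [None], whose only transitions are l. *)
Definition add_root (T : lts) (l : seq (R * T)) : lts :=
  @LTS (option T)
    (fun s a => if s is Some t then [seq Some u | u <- atrans t a] else [::])
    (fun s => [seq (e.1, Some e.2) | e <- if s is Some t then ptrans t else l]).

(* The process s_(M,a).  It is meaningful only if a \in M and P1 s M > 0; it is
   used below under these two conditions only, and then [head] returns the unique
   a-successor of a nondeterministic root. *)
Definition after (s : process) (M : {set A}) (a : A) : process :=
  if probabilistic (proc_root s) then
    @Process (add_root (new_root_ptrans (proc_root s) M a)) None
  else @Process s (head (proc_root s) (atrans (proc_root s) a)).

(* [Pn s [:: (M_1, a_1); ...; (M_(n-1), a_(n-1))] M_n] is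
   P^n_s(M_n | M_1, a_1, ..., M_(n-1), a_(n-1)), with None for undefined. *)
Fixpoint Pn (s : process) (h : seq ({set A} * A)) (M : {set A}) : option R :=
  if h is (M1, a1) :: h' then
    if 0 < P1 s M1 then Pn (after s M1 a1) h' M else None
  else Some (P1 s M).

Definition ready_history (h : seq ({set A} * A)) : bool :=
  all (fun Ma : {set A} * A => Ma.2 \in Ma.1) h.

(* Equality in [option R]: both sides are undefined, or both are defined and
   equal. *)
Definition ready_trace_equiv (s t : process) : Prop :=
  (forall M, P1 s M = P1 t M) /\
  (forall h M, ready_history h -> Pn s h M = Pn t h M).

End TransitionSystems.

Arguments LTS {R A state}.
Arguments Process {R A}.

Section Syntax.
Variables (R : realType) (disp : Order.disp_t) (A : finPOrderType disp).

Inductive term :=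
| Delta
| Ext of seq (A * term)
| PChoice of seq (R * term)
| Theta of term
| Par of term & term
| ParL of {set A} & term & term.

HB.instance Definition _ := gen_eqMixin term.

Fixpoint actions (t : term) : {set A} :=
  match t with
  | Delta => set0
  | Ext l => foldr (fun e B => e.1 |: (actions e.2 :|: B)) set0 l
  | PChoice l => foldr (fun e B => actions e.2 :|: B) set0 l
  | Theta p => actions p
  | Par p q | ParL _ p q => actions p :|: actions q
  end.

Definition share (p q : term) : bool := actions p :&: actions q != set0.

(* The pairs of operands of all the ParL nodes of a nested ParL composition. *)
Fixpoint operand_pairs (t : term) : seq (term * term) :=
  if t is ParL _ p q then (p, q) :: operand_pairs p ++ operand_pairs q
  else [::].

(* Among three distinct operands of a nested ParL composition, two are operands
   of a ParL node inside p or inside q, and the third lies in the other one. *)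
Definition no_triangle (p q : term) : bool :=
  let ok t := all (fun uv =>
    ~~ [&& share uv.1 uv.2, share uv.1 t & share uv.2 t]) in
  ok q (operand_pairs p) && ok p (operand_pairs q).

Section WellFormed.
Variable parL_ok : {set A} -> term -> term -> bool.

Fixpoint wf (t : term) : bool :=
  match t with
  | Delta => true
  | Ext l => uniq [seq e.1 | e <- l] && all (fun e => wf e.2) l
  | PChoice l => [&& all (fun e => 0 < e.1 <= 1) l, \sum_(e <- l) e.1 == 1
                  & all (fun e => wf e.2) l]
  | Theta p => wf p
  | Par p q => wf p && wf q
  | ParL L p q => [&& parL_ok L p q, wf p & wf q]
  end.

End WellFormed.

Definition csp_process : term -> bool :=
  wf (fun L p q => (L == actions p :&: actions q) && no_triangle p q).

(* The operands of ParL lose actions along transitions while L is unchanged, so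
   the states of a CSP_p process only satisfy this weaker condition, which is
   what determinism requires. *)
Definition csp_state : term -> bool :=
  wf (fun L p q => actions p :&: actions q \subset L).

Definition par_ptrans (op : term -> term -> term) (p q : term)
    (dp dq : seq (R * term)) : seq (R * term) :=
  match dp, dq with
  | [::], _ => [seq (f.1, op p f.2) | f <- dq]
  | _, [::] => [seq (e.1, op e.2 q) | e <- dp]
  | _, _ => [seq (e.1 * f.1, op e.2 f.2) | e <- dp, f <- dq]
  end.

Fixpoint dash (t : term) : seq (R * term) :=
  match t with
  | Delta | Ext _ => [::]
  | PChoice l => flatten [seq
      if nilp (dash e.2) then [:: e]
      else [seq (e.1 * f.1, f.2) | f <- dash e.2] | e <- l]
  | Theta p => [seq (e.1, Theta e.2) | e <- dash p]
  | Par p q => par_ptrans Par p q (dash p) (dash q)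
  | ParL L p q => par_ptrans (ParL L) p q (dash p) (dash q)
  end.

Fixpoint step (t : term) (a : A) : seq term :=
  match t with
  | Delta | PChoice _ => [::]
  | Ext l => [seq e.2 | e <- l & e.1 == a]
  | Theta p => if [exists b, (a < b)%O && ~~ nilp (step p b)] then [::]
               else [seq Theta p' | p' <- step p a]
  | Par p q => [seq Par p' q' | p' <- step p a, q' <- step q a]
  | ParL L p q =>
      if a \in L then [seq ParL L p' q' | p' <- step p a, q' <- step q a]
      else (if nilp (dash q) then [seq ParL L p' q | p' <- step p a] else [::])
        ++ (if nilp (dash p) then [seq ParL L p q' | q' <- step q a] else [::])
  end.

Definition process_of (t : term) : process R A := Process (LTS step dash) t.

(* Contexts have exactly one hole.  The sets L labelling ParL belong to the context
   and are not recomputed when the hole is filled: with L recomputed, the choice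
   would not distribute over _ ||_L a.Delta, as b.Delta ||_{} a.Delta can do a
   whereas (1/2 a.Delta (+) 1/2 b.Delta) ||_{a} a.Delta blocks it once b.Delta is
   chosen. *)
Inductive context :=
| Hole
| CExt of seq (A * term) & A & context & seq (A * term)
| CChoice of seq (R * term) & R & context & seq (R * term)
| CTheta of context
| CParl of context & term
| CParr of term & context
| CParLl of {set A} & context & term
| CParLr of {set A} & term & context.

Fixpoint fill (C : context) (p : term) : term :=
  match C with
  | Hole => p
  | CExt l1 a C' l2 => Ext (l1 ++ (a, fill C' p) :: l2)
  | CChoice l1 r C' l2 => PChoice (l1 ++ (r, fill C' p) :: l2)
  | CTheta C' => Theta (fill C' p)
  | CParl C' q => Par (fill C' p) q
  | CParr q C' => Par q (fill C' p)
  | CParLl L C' q => ParL L (fill C' p) q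
  | CParLr L q C' => ParL L q (fill C' p)
  end.

Definition prob_choice (I : finType) (pi : I -> R) (x : I -> term) : term :=
  PChoice [seq (pi i, x i) | i : I].

End Syntax.

Arguments Delta {R disp A}.
Arguments Ext {R disp A}.
Arguments PChoice {R disp A}.
Arguments Theta {R disp A}.
Arguments Par {R disp A}.
Arguments ParL {R disp A}.
Arguments Hole {R disp A}.

Section ProcessesArePTS.
Variables (R : realType) (disp : Order.disp_t) (A : finPOrderType disp).
Local Notation term := (term R A).
Implicit Types (t p q u : term) (a b : A).

Lemma term_ind_mem (P : term -> Prop) :
    P Delta ->
    (forall l : seq (A * term), (forall e : A * term, e \in l -> P e.2) -> P (Ext l)) ->
    (forall l : seq (R * term), (forall e : R * term, e \in l -> P e.2) -> P (PChoice l)) ->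
    (forall p, P p -> P (Theta p)) ->
    (forall p q, P p -> P q -> P (Par p q)) ->
    (forall L p q, P p -> P q -> P (ParL L p q)) ->
  forall t, P t.
Proof.
move=> PD PE PC PT PP PL; fix IH 1 => -[|l|l|p|p q|L p q]; [exact: PD| | | | |].
- apply: PE; elim: l => [|e l IHl] e'; first by clear IH; rewrite in_nil.
  rewrite inE => /orP[/eqP ->|/IHl h]; [exact: IH|exact: h].
- apply: PC; elim: l => [|e l IHl] e'; first by clear IH; rewrite in_nil.
  rewrite inE => /orP[/eqP ->|/IHl h]; [exact: IH|exact: h].
- by apply: PT.
- by apply: PP.
- by apply: PL.
Qed.

Lemma actions_mem_ext (l : seq (A * term)) e :
  e \in l -> e.1 |: actions e.2 \subset actions (Ext l).
Proof.
elim: l => [|f l IHl] //; rewrite inE => /orP[/eqP <-|/IHl h] /=.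
  by rewrite setUA subsetUl.
by apply: subset_trans h _; rewrite setUA subsetUr.
Qed.

Lemma actions_mem_choice (l : seq (R * term)) e :
  e \in l -> actions e.2 \subset actions (PChoice l).
Proof.
elim: l => [|f l IHl] //; rewrite inE => /orP[/eqP <-|/IHl h] /=.
  exact: subsetUl.
by apply: subset_trans h _; rewrite subsetUr.
Qed.

Lemma mem_par_ptrans (op : term -> term -> term) p q dp dq e :
  e \in par_ptrans op p q dp dq ->
  [\/ (dp = [::] /\ exists2 f, f \in dq & e = (f.1, op p f.2)),
      (dq = [::] /\ exists2 f, f \in dp & e = (f.1, op f.2 q)) |
      exists f g, [/\ f \in dp, g \in dq & e = (f.1 * g.1, op f.2 g.2)] ].
Proof.
case: dp => [|d dp]; first by move=> /mapP he; constructor 1.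
case: dq => [|d' dq]; first by move=> /mapP he; constructor 2.
by case/allpairsP => -[f g] [hf hg he]; constructor 3; exists f, g.
Qed.

Lemma par_ptrans_nil (op : term -> term -> term) p q dp dq :
  nilp (par_ptrans op p q dp dq) = nilp dp && nilp dq.
Proof. by case: dp => [|? ?]; case: dq. Qed.

Lemma mem_stepL L p q a t : t \in step (ParL L p q) a ->
  [\/ exists p' q', [/\ p' \in step p a, q' \in step q a & t = ParL L p' q'],
      [/\ nilp (dash q), a \notin L & (exists2 p', p' \in step p a & t = ParL L p' q)] |
      [/\ nilp (dash p), a \notin L & (exists2 q', q' \in step q a & t = ParL L p q')] ].
Proof.
rewrite /=; case: ifP => [_ /allpairsP[[p' q'] [/= h1 h2 h3]]|/negbT aL].
  by constructor 1; exists p', q'.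
rewrite mem_cat => /orP[]; case: ifP => // h /mapP he; first by constructor 2.
by constructor 3.
Qed.

Lemma mem_dash_choice (l : seq (R * term)) f : f \in dash (PChoice l) ->
  exists2 e, e \in l & (nilp (dash e.2) /\ f = e) \/
    exists2 g, g \in dash e.2 & f = (e.1 * g.1, g.2).
Proof.
move=> /flatten_mapP[e el]; case: ifP => [h|_] hf; exists e => //; last by right; apply/mapP.
by left; split=> //; move: hf; rewrite inE => /eqP.
Qed.

Lemma csp_process_state t : csp_process t -> csp_state t.
Proof.
rewrite /csp_process /csp_state.
elim/term_ind_mem: t => [|l IH|l IH|p IHp|p q IHp IHq|L p q IHp IHq] //=.
- by move=> /= /andP[-> /allP h] /=; apply/allP => e el; apply: IH (h _ el).
- by move=> /= /and3P[-> -> /allP h] /=; apply/allP => e el; apply: IH (h _ el).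
- by move=> /= /andP[/IHp -> /IHq ->].
- by move=> /= /and3P[/andP[/eqP -> _] /IHp -> /IHq ->]; rewrite subxx.
Qed.

Lemma dash_state t e : csp_state t -> e \in dash t ->
  [/\ csp_state e.2, actions e.2 \subset actions t, 0 < e.1 <= 1
    & nilp (dash e.2)].
Proof.
rewrite /csp_state.
have in01 (x y : R) : 0 < x <= 1 -> 0 < y <= 1 -> 0 < x * y <= 1.
  by move=> /andP[x0 x1] /andP[y0 y1]; rewrite mulr_gt0 // mulr_ile1 // ltW.
elim/term_ind_mem: t e => [|l IH|l IH|p IHp|p q IHp IHq|L p q IHp IHq] e //.
- move=> /= /and3P[/allP h01 _ /allP hw] /mem_dash_choice[f fl].
  have sub := actions_mem_choice fl.
  case=> [[hn ->]|[g hg ->]].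
    by split=> //; [apply: hw|apply: h01].
  have [h1 h2 h3 h4] := IH _ fl _ (hw _ fl) hg.
  split=> //; first exact: subset_trans h2 sub.
  exact: in01 (h01 _ fl) h3.
- move=> hp /mapP[f hf ->] /=; have [h1 h2 h3 h4] := IHp _ hp hf.
  by split=> //; rewrite /nilp size_map.
- move=> /= /andP[hp hq] /mem_par_ptrans[].
  + move=> [dp0 [f hf ->]]; have [h1 h2 h3 h4] := IHq _ hq hf.
    by rewrite /= par_ptrans_nil h4 hp h1 setUS // dp0.
  + move=> [dq0 [f hf ->]]; have [h1 h2 h3 h4] := IHp _ hp hf.
    by rewrite /= par_ptrans_nil h4 hq h1 setSU // dq0.
  + move=> [f [g [hf hg ->]]]; have [h1 h2 h3 h4] := IHp _ hp hf.
    have [k1 k2 k3 k4] := IHq _ hq hg.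
    by rewrite /= par_ptrans_nil h4 k4 h1 k1 setUSS // in01.
- move=> /= /and3P[hL hp hq] /mem_par_ptrans[].
  + move=> [dp0 [f hf ->]]; have [h1 h2 h3 h4] := IHq _ hq hf.
    rewrite /= par_ptrans_nil h4 hp h1 setUS // dp0 !andbT; split=> //.
    exact: subset_trans (setIS _ h2) hL.
  + move=> [dq0 [f hf ->]]; have [h1 h2 h3 h4] := IHp _ hp hf.
    rewrite /= par_ptrans_nil h4 hq h1 setSU // dq0 !andbT; split=> //.
    exact: subset_trans (setSI _ h2) hL.
  + move=> [f [g [hf hg ->]]]; have [h1 h2 h3 h4] := IHp _ hp hf.
    have [k1 k2 k3 k4] := IHq _ hq hg.
    rewrite /= par_ptrans_nil h4 k4 h1 k1 setUSS // in01 // !andbT; split=> //.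
    exact: subset_trans (setISS h2 k2) hL.
Qed.

Lemma step_state t a u : csp_state t -> u \in step t a ->
  [/\ csp_state u, actions u \subset actions t & a \in actions t].
Proof.
rewrite /csp_state.
elim/term_ind_mem: t u => [|l IH|l IH|p IHp|p q IHp IHq|L p q IHp IHq] u //.
- move=> /= /andP[_ /allP hw] /mapP[e]; rewrite mem_filter => /andP[/eqP <- el] ->.
  have := actions_mem_ext el; rewrite subUset sub1set => /andP[h1 h2].
  by split=> //; apply: hw.
- move=> hp /=; case: ifP => // _ /mapP[p' hp' ->] /=.
  exact: IHp.
- move=> /= /andP[hp hq] /allpairsP[[p' q'] [/= hp' hq' ->]].
  have [h1 h2 h3] := IHp _ hp hp'; have [k1 k2 k3] := IHq _ hq hq'.
  by rewrite /= h1 k1 setUSS // inE h3.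
- move=> /= /and3P[hL hp hq] /mem_stepL[].
  + move=> [p' [q' [hp' hq' ->]]].
    have [h1 h2 h3] := IHp _ hp hp'; have [k1 k2 k3] := IHq _ hq hq'.
    rewrite /= h1 k1 setUSS // inE h3 !andbT; split=> //.
    exact: subset_trans (setISS h2 k2) hL.
  + move=> [_ _ [p' hp' ->]]; have [h1 h2 h3] := IHp _ hp hp'.
    rewrite /= h1 hq setSU // inE h3 !andbT; split=> //.
    exact: subset_trans (setSI _ h2) hL.
  + move=> [_ _ [q' hq' ->]]; have [h1 h2 h3] := IHq _ hq hq'.
    rewrite /= h1 hp setUS // inE h3 orbT !andbT; split=> //.
    exact: subset_trans (setIS _ h2) hL.
Qed.

Lemma step_deterministic t a : csp_state t -> (size (step t a) <= 1)%N.
Proof.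
rewrite /csp_state.
elim/term_ind_mem: t => [|l _|l IH|p IHp|p q IHp IHq|L p q IHp IHq] //.
- move=> /= /andP[hu _] /=; rewrite size_map size_filter.
  have -> : count (fun e : A * term => e.1 == a) l
          = count_mem a [seq e.1 | e <- l] by rewrite count_map.
  by rewrite count_uniq_mem //; case: (_ \in _).
- by move=> hp /=; case: ifP => // _; rewrite size_map; exact: IHp.
- move=> /= /andP[/IHp hp /IHq hq] /=; rewrite size_allpairs.
  by rewrite -(muln1 1%N) leq_mul.
- move=> /= /and3P[hL wp wq].
  have hp := IHp wp; have hq := IHq wq; rewrite /=.
  case: ifP => aL; first by rewrite size_allpairs -(muln1 1%N) leq_mul.
  rewrite size_cat.
  have [p0|p1] := posnP (size (step p a)).
    by rewrite (size0nil p0); case: ifP => _; case: ifP => _ //=; rewrite size_map.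
  have [q0|q1] := posnP (size (step q a)).
    by rewrite (size0nil q0); case: ifP => _; case: ifP => _ //=;
      rewrite ?size_map ?addn0.
  move: p1 q1; rewrite -!has_predT => /hasP[p' hp' _] /hasP[q' hq' _].
  have [_ _ ap] := step_state wp hp'; have [_ _ aq] := step_state wq hq'.
  by move: hL => /subsetP/(_ a); rewrite inE ap aq aL => /(_ isT).
Qed.

Lemma dash_step t a : ~~ nilp (dash t) -> step t a = [::].
Proof.
elim/term_ind_mem: t a => [|l _|l IH|p IHp|p q IHp IHq|L p q IHp IHq] a //.
- rewrite /= /nilp size_map => hp; rewrite (IHp a hp); by case: ifP.
- rewrite /= par_ptrans_nil negb_and => /orP[hp|hq]; first by rewrite IHp.
  by rewrite (IHq a hq); elim: (step p a).
- rewrite /= par_ptrans_nil negb_and => /orP[hp|hq].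
    by rewrite (IHp a hp) (negbTE hp) /=; case: ifP => // _; case: ifP.
  rewrite (IHq a hq) (negbTE hq) /=; case: ifP => _; last by case: ifP.
  by elim: (step p a).
Qed.

Lemma dash_mass t : csp_state t -> ~~ nilp (dash t) ->
  \sum_(e <- dash t) e.1 = 1.
Proof.
rewrite /csp_state.
have par op p q : (~~ nilp (dash p) -> \sum_(e <- dash p) e.1 = 1) ->
    (~~ nilp (dash q) -> \sum_(e <- dash q) e.1 = 1) ->
    ~~ nilp (par_ptrans op p q (dash p) (dash q)) ->
    \sum_(e <- par_ptrans op p q (dash p) (dash q)) e.1 = 1.
  case: (dash p) => [|e0 dp].
    by move=> _ hq; rewrite par_ptrans_nil /= big_map => /hq.
  case: (dash q) => [|f0 dq].
    by move=> hp _; rewrite par_ptrans_nil andbT [LHS]big_map => /hp.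
  move=> /(_ isT) hp /(_ isT) hq _.
  rewrite [LHS]big_allpairs_dep /= -[RHS]hp; apply: eq_bigr => e _.
  by rewrite -mulr_sumr hq mulr1.
elim/term_ind_mem: t => [|l _|l IH|p IHp|p q IHp IHq|L p q IHp IHq] //.
- move=> /= /and3P[_ /eqP hs /allP hw] _; rewrite /= big_flatten big_map -[RHS]hs.
  apply: eq_big_seq => e el; case: ifP => [_|/negbT hn]; first by rewrite big_seq1.
  by rewrite big_map /= -mulr_sumr (IH _ el (hw _ el) hn) mulr1.
- by move=> hp; rewrite /= /nilp size_map big_map => hn; apply: IHp.
- by move=> /= /andP[hp hq]; apply: par; [apply: IHp|apply: IHq].
- by move=> /= /and3P[_ hp hq]; apply: par; [apply: IHp|apply: IHq].
Qed.

Fixpoint derivatives t : seq term :=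
  match t with
  | Delta => [:: t]
  | Ext l => t :: flatten [seq derivatives e.2 | e <- l]
  | PChoice l => t :: flatten [seq derivatives e.2 | e <- l]
  | Theta p => [seq Theta p' | p' <- derivatives p]
  | Par p q => [seq Par p' q' | p' <- derivatives p, q' <- derivatives q]
  | ParL L p q => [seq ParL L p' q' | p' <- derivatives p, q' <- derivatives q]
  end.

Lemma derivatives_refl t : t \in derivatives t.
Proof.
elim/term_ind_mem: t => [|l _|l _|p IHp|p q IHp IHq|L p q IHp IHq] /=;
  rewrite ?mem_head //; [exact: map_f|exact: allpairs_f|exact: allpairs_f].
Qed.

Lemma derivatives_step t u a v :
  u \in derivatives t -> v \in step u a -> v \in derivatives t.
Proof.
elim/term_ind_mem: t u v => [|l IH|l IH|p IHp|p q IHp IHq|L p q IHp IHq] u v /=.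
- by rewrite inE => /eqP ->.
- rewrite !inE => /orP[/eqP ->|/flatten_mapP[e el hu] hv]; last first.
    by apply/orP; right; apply/flatten_mapP; exists e => //; apply: IH hv.
  move=> /mapP[e]; rewrite mem_filter => /andP[_ el] ->.
  apply/orP; right; apply/flatten_mapP; exists e => //; exact: derivatives_refl.
- rewrite !inE => /orP[/eqP -> //|/flatten_mapP[e el hu] hv].
  by apply/orP; right; apply/flatten_mapP; exists e => //; apply: IH hv.
- move=> /mapP[p' hp' ->] /=; case: ifP => // _ /mapP[p'' hp'' ->].
  by apply: map_f; apply: IHp hp''.
- move=> /allpairsP[[p' q'] [/= hp' hq' ->]].
  move=> /allpairsP[[p'' q''] [/= hp'' hq'' ->]].
  by apply: allpairs_f; [apply: IHp hp''|apply: IHq hq''].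
- move=> /allpairsP[[p' q'] [/= hp' hq' ->]] /mem_stepL[].
  + move=> [p'' [q'' [hp'' hq'' ->]]].
    by apply: allpairs_f; [apply: IHp hp''|apply: IHq hq''].
  + by move=> [_ _ [p'' hp'' ->]]; apply: allpairs_f => //; apply: IHp hp''.
  + by move=> [_ _ [q'' hq'' ->]]; apply: allpairs_f => //; apply: IHq hq''.
Qed.

Lemma derivatives_dash t u e :
  u \in derivatives t -> e \in dash u -> e.2 \in derivatives t.
Proof.
elim/term_ind_mem: t u e => [|l IH|l IH|p IHp|p q IHp IHq|L p q IHp IHq] u e /=.
- by rewrite inE => /eqP ->.
- rewrite !inE => /orP[/eqP -> //|/flatten_mapP[f fl hu] he].
  by apply/orP; right; apply/flatten_mapP; exists f => //; apply: IH he.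
- rewrite !inE => /orP[/eqP ->|/flatten_mapP[f fl hu] he]; last first.
    by apply/orP; right; apply/flatten_mapP; exists f => //; apply: IH he.
  move=> /mem_dash_choice[f fl h]; apply/orP; right.
  apply/flatten_mapP; exists f => //.
  case: h => [[_ ->]|[g hg ->]]; first exact: derivatives_refl.
  exact: IH (derivatives_refl _) hg.
- move=> /mapP[p' hp' ->] /mapP[f hf ->] /=.
  by apply: map_f; apply: IHp hf.
- move=> /allpairsP[[p' q'] [/= hp' hq' ->]] /mem_par_ptrans[].
  + by move=> [_ [f hf ->]]; apply: allpairs_f => //; apply: IHq hf.
  + by move=> [_ [f hf ->]]; apply: allpairs_f => //; apply: IHp hf.
  + move=> [f [g [hf hg ->]]].
    by apply: allpairs_f; [apply: IHp hf|apply: IHq hg].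
- move=> /allpairsP[[p' q'] [/= hp' hq' ->]] /mem_par_ptrans[].
  + by move=> [_ [f hf ->]]; apply: allpairs_f => //; apply: IHq hf.
  + by move=> [_ [f hf ->]]; apply: allpairs_f => //; apply: IHp hf.
  + move=> [f [g [hf hg ->]]].
    by apply: allpairs_f; [apply: IHp hf|apply: IHq hg].
Qed.

(* The process denoted by a CSP_p state, in particular (by [csp_process_state]) by
   a CSP_p process, is a finite probabilistic transition system. *)
Lemma csp_state_is_pts t : csp_state t -> is_pts (process_of t).
Proof.
move=> ht.
have hr u : reachable (proc_root (process_of t)) u ->
    csp_state u /\ u \in derivatives t.
  elim=> [|v a w _ [hv dv] hw|v e _ [hv dv] he].
  - by split=> //; exact: derivatives_refl.
  - by have [? _ _] := step_state hv hw; split=> //; apply: derivatives_step hw.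
  - by have [? _ _ _] := dash_state hv he; split=> //; apply: derivatives_dash he.
split=> [|u /hr[hu _] a|u _ pu a|u /hr[hu _] e he|u /hr[hu _] pu].
- by exists (derivatives t) => u /hr[].
- exact: step_deterministic.
- exact: dash_step.
- by have [_ _ h1 h2] := dash_state hu he; split; rewrite // /probabilistic negbK.
- exact: dash_mass.
Qed.

(* Once the left-hand side is a CSP_p process, both terms denote probabilistic
   transition systems, although L may fail to be exactly the set of common
   actions in fill C (x i). *)
Lemma fill_is_pts (C : context R A) (I : finType) (pi : I -> R)
    (x : I -> term) :
  csp_process (fill C (prob_choice pi x)) ->
  is_pts (process_of (fill C (prob_choice pi x))) /\
  is_pts (process_of (prob_choice pi (fun i => fill C (x i)))).
Proof.
move=> /csp_process_state hC; split; first exact: csp_state_is_pts.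
apply: csp_state_is_pts.
have chP : csp_state (prob_choice pi x) -> [/\ (forall i, 0 < pi i <= 1),
    \sum_i pi i = 1 & forall i, csp_state (x i)].
  move=> /and3P[/allP h1 /eqP h2 /allP h3]; split.
  - by move=> i; apply: (h1 (pi i, x i)); apply/imageP; exists i.
  - by rewrite big_image in h2.
  - by move=> i; apply: (h3 (pi i, x i)); apply/imageP; exists i.
have mem i : actions (x i) \subset actions (prob_choice pi x).
  by apply: (actions_mem_choice (e := (pi i, x i))); apply/imageP; exists i.
have fillS : forall D i, actions (fill D (x i))
    \subset actions (fill D (prob_choice pi x)).
  move=> D i; elim: D => [|l1 a D IH l2|l1 r D IH l2|D IH|D IH q|q D IH
      |L D IH q|L q D IH] //=; rewrite ?setSU ?setUS //.
  - by elim: l1 => [|e l1 IHl] /=; rewrite !setUS // setSU.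
  - by elim: l1 => [|e l1 IHl] /=; rewrite ?setUS // setSU.
have hole D : csp_state (fill D (prob_choice pi x)) -> csp_state (prob_choice pi x).
  elim: D => [|l1 a D IH l2|l1 r D IH l2|D IH|D IH q|q D IH
      |L D IH q|L q D IH] //=; rewrite /csp_state /=.
  - by rewrite all_cat /= => /andP[_ /and3P[_ /IH]].
  - by rewrite !all_cat /= => /and3P[_ _ /and3P[_ /IH]].
  - by move=> /andP[/IH].
  - by move=> /andP[_ /IH].
  - by move=> /and3P[_ /IH].
  - by move=> /and3P[_ _ /IH].
have [h01 hsum hx] := chP (hole _ hC).
have filled D i : csp_state (fill D (prob_choice pi x)) -> csp_state (fill D (x i)).
  elim: D => [|l1 a D IH l2|l1 r D IH l2|D IH|D IH q|q D IH
      |L D IH q|L q D IH] //=; rewrite /csp_state /=.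
  - rewrite !map_cat !all_cat /= => /andP[-> /and3P[-> /IH h ->]].
    by rewrite andbT.
  - rewrite !all_cat /= !big_cat /= !big_cons /=.
    move=> /and3P[/and3P[-> -> ->] -> /and3P[-> /IH h ->]].
    by rewrite !andbT.
  - by move=> /andP[/IH h ->]; rewrite andbT.
  - by move=> /andP[-> /IH].
  - move=> /and3P[hL /IH h ->]; rewrite andbT; apply/andP; split=> //.
    exact: subset_trans (setSI _ (fillS D i)) hL.
  - move=> /and3P[hL -> /IH h]; rewrite /=; apply/andP; split=> //.
    exact: subset_trans (setIS _ (fillS D i)) hL.
rewrite /csp_state /=; apply/and3P; split.
- by apply/allP => _ /imageP[i _ ->]; exact: h01.
- by rewrite big_image /= hsum.
- by apply/allP => _ /imageP[i _ ->]; apply: filled.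
Qed.

End ProcessesArePTS.

(* Main.v *)
Require Import Defs.
From HB Require Import structures.
From mathcomp Require Import all_boot all_order all_algebra.
From mathcomp Require Import boolp reals.

Set Implicit Arguments.
Unset Strict Implicit.
Unset Printing Implicit Defensive.

Import Order.TTheory GRing.Theory Num.Theory.
Local Open Scope ring_scope.

(* The conditional probabilities P^n are quotients of joint weights: the weight of
   a ready trace is the probability of seeing its menus when its actions are
   chosen.  Weights need no renormalisation, hence are linear in the process, and
   processes with equal weights are ready trace equivalent.  Each operator is
   compositional for weights: a weight of op(p), as a function of a
   nondeterministic state p, is a linear combination of weights of p.  So the
   distribution law passes through every context by induction. *)

(** * Expectations over a probabilistic step, and joint weights *)

Section Weights.
Variables (R : realType) (A : finType).
Implicit Type h : seq ({set A} * A).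

(** A nondeterministic state counts as a point mass at itself, which turns the probabilistic rules
    of parallel composition into one iterated expectation. *)
Definition expect (T : lts R A) (s : T) (G : T -> R) : R :=
  if nilp (ptrans s) then G s else \sum_(e <- ptrans s) e.1 * G e.2.

(** Meant for nondeterministic [s]; [mass] averages over an initial probabilistic choice. *)
Fixpoint weight (T : lts R A) (s : T) h (M : {set A}) : R :=
  if h is (M1, a) :: h' then
    (menu s == M1)%:R *
      \sum_(u <- atrans s a) expect u (fun v => weight v h' M)
  else (menu s == M)%:R.

Definition mass (T : lts R A) (s : T) h (M : {set A}) : R :=
  expect s (fun t => weight t h M).

Lemma eq_expect (T : lts R A) (s : T) (G G' : T -> R) :
  G =1 G' -> expect s G = expect s G'.
Proof. by move=> /funext ->. Qed.

Lemma expectZ (T : lts R A) (s : T) c (G : T -> R) :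
  expect s (fun t => c * G t) = c * expect s G.
Proof.
rewrite /expect; case: ifP => // _; rewrite mulr_sumr.
by apply: eq_bigr => e _; rewrite mulrCA.
Qed.

Lemma expect_sum (T : lts R A) (s : T) (K : Type) (r : seq K) (G : K -> T -> R) :
  expect s (fun t => \sum_(k <- r) G k t) = \sum_(k <- r) expect s (G k).
Proof.
rewrite /expect; case: ifP => // _; rewrite exchange_big /=.
by apply: eq_bigr => e _; rewrite mulr_sumr.
Qed.

Lemma expect_exchange (T U : lts R A) (s : T) (u : U) (G : T -> U -> R) :
  expect s (fun t => expect u (G t)) = expect u (fun v => expect s (G^~ v)).
Proof.
rewrite [LHS]/expect; case: ifP => hs.
  by apply: eq_expect => v; rewrite /expect hs.
transitivity (\sum_(e <- ptrans s) expect u (fun v => e.1 * G e.2 v)).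
  by apply: eq_bigr => e _; rewrite expectZ.
by rewrite -expect_sum; apply: eq_expect => v; rewrite /expect hs.
Qed.

Lemma P1_mass (s : process R A) M : P1 s M = mass (proc_root s) [::] M.
Proof. by rewrite /P1 /mass /expect /probabilistic; case: nilp. Qed.

(** * Conditioning on a first menu and action *)

Lemma weight_add_root (T : lts R A) l h M (t : T) :
  weight (Some t : add_root l) h M = weight t h M.
Proof.
have menuE (u : T) : menu (Some u : add_root l) = menu u.
  by apply/setP => a; rewrite !inE /nilp size_map.
elim: h t => [|[M1 a] h IH] t /=; rewrite menuE //.
congr (_ * _); rewrite big_map; apply: eq_bigr => u _.
rewrite /expect /= {1}/nilp size_map -/(nilp _); case: ifP => // _.
by rewrite big_map; apply: eq_bigr => e _; rewrite IH.
Qed.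

(** An edge of the new root composes a choice, an action and the next choice, always divided by the
    same normaliser; the sum is thus an expectation conditioned on the menu [M]. *)
Lemma sum_new_root_ptrans (T : lts R A) (s : T) M a (G : T -> R) :
  \sum_(e <- new_root_ptrans s M a) e.1 * G e.2 =
  (\sum_(e <- ptrans s) e.1 *
     ((menu e.2 == M)%:R * \sum_(t <- atrans e.2 a) expect t G)) /
  \sum_(e <- ptrans s | menu e.2 == M) e.1.
Proof.
rewrite /new_root_ptrans /=; set pi := \sum_(e <- ptrans s | _) _.
rewrite big_flatten big_map big_filter mulr_suml big_mkcond.
apply: eq_bigr => e _; case: ifP => _; last by rewrite mul0r mulr0 mul0r.
rewrite big_flatten big_map mul1r mulrAC mulr_sumr; apply: eq_bigr => t _.
rewrite /expect; case: ifP => _; first by rewrite big_seq1.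
by rewrite big_map mulr_sumr; apply: eq_bigr => f _; rewrite !mulrA (mulrAC e.1).
Qed.

(** A root without edges would count as nondeterministic. Positivity of [P1 s M] yields a target
    with menu [M], and [a \in M] an [a]-successor of it, which contributes an edge. *)
Lemma new_root_ptrans_neq0 (s : process R A) M a :
  probabilistic (proc_root s) -> 0 < P1 s M -> a \in M ->
  ~~ nilp (new_root_ptrans (proc_root s) M a).
Proof.
rewrite /P1 => -> pos aM; apply: contraTN pos => /nilP new0.
rewrite big_seq big1 ?ltxx // => e es; case: eqP => [eM|]; last by rewrite mulr0.
move: aM; rewrite -eM inE; case steps : (atrans e.2 a) => [|t l] // _.
suff : new_root_ptrans (proc_root s) M a != [::] by rewrite new0.
have : e \in [seq e <- ptrans (proc_root s) | menu e.2 == M].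
  by rewrite mem_filter eM eqxx.
rewrite /new_root_ptrans /=; move: (\sum_(_ <- _ | _) _) => pi.
case/splitPr => l1 l2; rewrite map_cat flatten_cat /= steps /=.
rewrite -size_eq0 !size_cat; case: ifP => [_|/negbT]; first by rewrite addnS.
by rewrite size_map; case: (ptrans t) => // f l' _; rewrite /= addnS.
Qed.

(* [after] preserves the left disjunct: the root it creates is probabilistic. *)
Definition deterministic_from (s : process R A) : Prop :=
  probabilistic (proc_root s) \/
  (forall t, reachable (proc_root s) t -> forall a, (size (atrans t a) <= 1)%N).

(** The chain rule for conditional probabilities. At a nondeterministic root it rests on
    determinism: [after] follows one successor, whereas [weight] sums over all. *)
Lemma after_spec (s : process R A) M a :
  deterministic_from s -> 0 < P1 s M -> a \in M ->
  deterministic_from (after s M a) /\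
  forall h N, mass (proc_root (after s M a)) h N =
              mass (proc_root s) ((M, a) :: h) N / P1 s M.
Proof.
move=> det pos aM; have := @new_root_ptrans_neq0 s M a.
rewrite /after; case: ifP => ps; last first.
  move=> _; case: det => [|det]; first by rewrite ps.
  move: pos; rewrite /P1 ps; case: eqP => [sM|_]; last by rewrite ltxx.
  have := det _ (reach_refl _) a; move: aM; rewrite -sM inE.
  case steps : (atrans (proc_root s) a) => [|u [|v l]] // _ _ _ /=.
  split=> [|h N].
    right=> t ut; apply: det; elim: ut => [|t' b v _ + hv|t' e _ + he].
    - by apply: (reach_act (a := a)); [exact: reach_refl | rewrite steps mem_head].
    - by move=> st'; apply: reach_act st' hv.
    - by move=> st'; apply: reach_prob st' he.
  (* The menu of a nondeterministic root has probability 1, so the division is by 1. *)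
  rewrite divr1 [RHS]/mass /expect -[nilp _]negbK -/(probabilistic _) ps /=.
  by rewrite sM eqxx mul1r steps big_seq1.
move=> /(_ isT pos aM) new_neq0; split.
  by left; rewrite /probabilistic /= /nilp size_map.
move=> h N; rewrite [LHS]/mass /expect /= {1}/nilp size_map -/(nilp _).
rewrite (negbTE new_neq0) big_map /=.
under eq_bigr do rewrite weight_add_root.
rewrite (sum_new_root_ptrans _ _ _ (fun t => weight t h N)); congr (_ / _).
  by rewrite /mass /expect -[nilp _]negbK -/(probabilistic _) ps.
by rewrite /P1 ps big_mkcond; apply: eq_bigr => e _; case: ifP; rewrite ?mulr1 ?mulr0.
Qed.

(** Each step divides both families of weights by the same [P1], so their equality passes to the
    residual processes. *)
Lemma mass_ready_trace_equiv (s t : process R A) :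
  deterministic_from s -> deterministic_from t ->
  (forall h M, mass (proc_root s) h M = mass (proc_root t) h M) ->
  ready_trace_equiv s t.
Proof.
move=> ds dt est; split=> [M|h]; first by rewrite !P1_mass est.
elim: h s t ds dt est => [|[M1 a] h IH] s t ds dt est M /=.
  by rewrite !P1_mass est.
have e1 : P1 t M1 = P1 s M1 by rewrite !P1_mass est.
move=> /andP[aM1 hh]; rewrite e1; case: ifP => // pos.
have [ds' es] := after_spec ds pos aM1.
have [dt' et] := after_spec dt (etrans (congr1 (Order.lt 0) e1) pos) aM1.
by apply: IH => // h' N; rewrite es et est e1.
Qed.

End Weights.

Section Contexts.
Variables (R : realType) (disp : Order.disp_t) (A : finPOrderType disp).
Local Notation term := (term R A).
Local Notation csp := (@LTS R A term (@step R disp A) (@dash R disp A)).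
Implicit Types (p q t u : term) (h : seq ({set A} * A)) (G : term -> R).

(** * Expectations in the transition system of terms *)

Lemma dash_nondeterministic t e : e \in dash t -> nilp (dash e.2).
Proof.
have par (op : term -> term -> term) p q :
    (forall u v, dash (op u v) = par_ptrans op u v (dash u) (dash v)) ->
    (forall e, e \in dash p -> nilp (dash e.2)) ->
    (forall e, e \in dash q -> nilp (dash e.2)) ->
    forall e, e \in dash (op p q) -> nilp (dash e.2).
  move=> opE hp hq e'; rewrite opE => /mem_par_ptrans[].
  - by move=> [dp0 [f /hq hf ->]]; rewrite opE par_ptrans_nil dp0.
  - by move=> [dq0 [f /hp hf ->]]; rewrite opE par_ptrans_nil dq0 andbT.
  - by move=> [f [g [/hp hf /hq hg ->]]]; rewrite opE par_ptrans_nil hf.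
elim/term_ind_mem: t e => [|l _|l IH|p IHp|p q IHp IHq|L p q IHp IHq] e //.
- by move=> /mem_dash_choice[f fl [[hn ->]|[g hg ->]]] //=; apply: IH hg.
- by move=> /mapP[f hf ->]; rewrite /= /nilp size_map; apply: IHp hf.
- exact: (par (@Par R disp A)).
- exact: (par (@ParL R disp A L)).
Qed.

(** This is why [observable] constrains values at nondeterministic states only. *)
Lemma eq_expect_nondeterministic (s : csp) G G' :
  (forall t, nilp (dash t) -> G t = G' t) -> expect s G = expect s G'.
Proof.
move=> eG; rewrite /expect; case: ifP => [/eG //|_].
by apply: eq_big_seq => e /dash_nondeterministic/eG ->.
Qed.

(** An empty choice has no edges, so [expect] would evaluate [G] at the choice itself. *)
Lemma expect_PChoice (l : seq (R * term)) G : l != [::] ->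
  expect (PChoice l : csp) G = \sum_(e <- l) e.1 * expect (e.2 : csp) G.
Proof.
move=> l0; rewrite /expect ifF /=.
  rewrite big_flatten big_map; apply: eq_bigr => e _.
  case: ifP => _; first by rewrite big_seq1.
  by rewrite big_map mulr_sumr; apply: eq_bigr => f _; rewrite mulrA.
case: l l0 => [|e l] // _; rewrite /nilp /= size_cat.
by case de : (dash e.2).
Qed.

Lemma expect_Theta p G :
  expect (Theta p : csp) G = expect (p : csp) (fun p' => G (Theta p')).
Proof. by rewrite /expect /= {1}/nilp size_map -/(nilp _) big_map. Qed.

Lemma expect_par_ptrans (op : term -> term -> term) p q G :
  dash (op p q) = par_ptrans op p q (dash p) (dash q) ->
  expect (op p q : csp) G =
  expect (p : csp) (fun p' => expect (q : csp) (fun q' => G (op p' q'))).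
Proof.
rewrite /expect /= => ->; rewrite par_ptrans_nil.
case: (dash p) => [|e dp]; case: (dash q) => [|f dq] //.
- by rewrite [LHS]big_map.
- by rewrite [LHS]big_map.
- rewrite [LHS]big_allpairs_dep /=; apply: eq_bigr => e' _.
  by rewrite mulr_sumr; apply: eq_bigr => f' _; rewrite mulrA.
Qed.

(* Membership in the span of the weights, on nondeterministic states. *)
Definition observable G : Prop :=
  exists l : seq (R * (seq ({set A} * A) * {set A})), forall t, nilp (dash t) ->
    G t = \sum_(k <- l) k.1 * weight (t : csp) k.2.1 k.2.2.

(** * Closure properties of the span of the weights *)

Lemma eq_observable G G' : (forall t, nilp (dash t) -> G t = G' t) ->
  observable G' -> observable G.
Proof. by move=> eG [l hl]; exists l => t ht; rewrite eG // hl. Qed.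

Lemma observableZ c G : observable G -> observable (fun t => c * G t).
Proof.
move=> [l hl]; exists [seq (c * k.1, k.2) | k <- l] => t ht.
by rewrite big_map hl // mulr_sumr; apply: eq_bigr => k _; rewrite mulrA.
Qed.

Lemma observableD G G' :
  observable G -> observable G' -> observable (fun t => G t + G' t).
Proof.
by move=> [l hl] [l' hl']; exists (l ++ l') => t ht; rewrite big_cat hl // hl'.
Qed.

Lemma observable_sum (K : eqType) (r : seq K) (G : K -> term -> R) :
  (forall k, k \in r -> observable (G k)) ->
  observable (fun t => \sum_(k <- r) G k t).
Proof.
elim: r => [|k r IH] hG; first by exists [::] => t _; rewrite !big_nil.
apply: eq_observable (observableD (hG k _) (IH _)); last first.
- by move=> j jr; apply: hG; rewrite inE jr orbT.
- exact: mem_head.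
- by move=> t _; rewrite big_cons.
Qed.

(** A weight vanishes unless the state has the first menu of the trace, so the indicator selects the
    terms whose trace starts with [M]. *)
Lemma observable_menu M G :
  observable G -> observable (fun t => (menu (t : csp) == M)%:R * G t).
Proof.
(* With an empty history the first menu is the final one, hence the default [k.2.2]. *)
move=> [l hl]; exists [seq k <- l | head k.2.2 (unzip1 k.2.1) == M] => t ht.
rewrite big_filter [RHS]big_mkcond hl // mulr_sumr; apply: eq_bigr => k _.
rewrite mulrCA; case: k => c [[|[M1 a] h] N] /=.
  case: (eqVneq N M) => [->|neq]; first by case: eqP; rewrite ?mul1r ?mul0r.
  by case: eqP => [->|_]; rewrite ?mul0r ?mulr0 // eq_sym (negbTE neq) !mulr0.
case: (eqVneq M1 M) => [->|neq]; first by case: eqP; rewrite ?mul1r ?mul0r.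
by case: eqP => [->|_]; rewrite ?mul0r ?mulr0 // eq_sym (negbTE neq) mul0r !mulr0.
Qed.

(** There are finitely many menus, so a case distinction on the menu is a finite sum of products
    with indicators. *)
Lemma observable_dep_menu (G : {set A} -> term -> R) :
  (forall M, observable (G M)) -> observable (fun t => G (menu (t : csp)) t).
Proof.
move=> hG; apply: eq_observable (observable_sum (r := enum {set A})
  (fun M _ => observable_menu M (hG M))) => t _.
rewrite big_enum (bigD1 (menu (t : csp))) //= eqxx mul1r big1 ?addr0 // => M neq.
by rewrite eq_sym (negbTE neq) mul0r.
Qed.

(** The weights of the traces of length 1 are the indicators of the menus, and these add up to 1. *)
Lemma observable_cst c : observable (fun=> c).
Proof.
exists [seq (c, ([::], M)) | M <- enum {set A}] => t _; rewrite big_map big_enum.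
rewrite (bigD1 (menu (t : csp))) //= eqxx mulr1 big1 ?addr0 // => M neq.
by rewrite eq_sym (negbTE neq) mulr0.
Qed.

(** Prefixing [(M, a)] to each trace performs the step, up to the indicator of [M], which is 1 once
    [M] is taken to be the menu of the state. *)
Lemma observable_step a G : observable G ->
  observable (fun t => \sum_(u <- step t a) expect (u : csp) G).
Proof.
move=> [l hl].
pose F M t := \sum_(k <- l) k.1 * weight (t : csp) ((M, a) :: k.2.1) k.2.2.
apply: eq_observable (observable_dep_menu (G := F) _); last first.
  by move=> M; exists [seq (k.1, ((M, a) :: k.2.1, k.2.2)) | k <- l] => t _;
    rewrite big_map.
move=> t _; rewrite /F /= eqxx; under [RHS]eq_bigr do rewrite mul1r mulr_sumr.
rewrite exchange_big; apply: eq_bigr => u _ /=.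
under [RHS]eq_bigr do rewrite -expectZ.
by rewrite -expect_sum; apply: eq_expect_nondeterministic.
Qed.

Lemma observable_expect (s : csp) (G : term -> term -> R) :
  (forall u, nilp (dash u) -> observable (G u)) ->
  observable (fun t => expect s (fun u => G u t)).
Proof.
move=> hG; rewrite /expect; case hs : (nilp _); first exact: hG.
by apply: observable_sum => e /dash_nondeterministic/hG/observableZ.
Qed.

(** Both sides are linear in [G], so the identity extends from weights to their span. *)
Lemma expect_observable (I : finType) (pi : I -> R) (s : csp) (y : I -> csp) G :
  (forall h M, mass s h M = \sum_i pi i * mass (y i) h M) ->
  observable G -> expect s G = \sum_i pi i * expect (y i) G.
Proof.
move=> hs [l hl].
have E (u : csp) : expect u G = \sum_(k <- l) k.1 * mass u k.2.1 k.2.2.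
  rewrite (eq_expect_nondeterministic _ hl) expect_sum.
  by apply: eq_bigr => k _; rewrite expectZ.
rewrite E; under eq_bigr do rewrite hs mulr_sumr.
rewrite exchange_big; apply: eq_bigr => i _ /=.
by rewrite E mulr_sumr; apply: eq_bigr => k _; rewrite mulrCA.
Qed.

(** * Compositionality of priority and parallel composition *)

(** Which actions priority blocks depends only on the menu of the operand, so blocking is a
    menu-dependent coefficient of the step. *)
Lemma observable_Theta h M : observable (fun p => weight (Theta p : csp) h M).
Proof.
pose top (N : {set A}) := [set a in N | ~~ [exists b, (a < b)%O && (b \in N)]].
have exE p a : [exists b, (a < b)%O && (b \in menu (p : csp))] =
               [exists b, (a < b)%O && ~~ nilp (step p b)].
  by apply: eq_existsb => b; rewrite inE.
have menuE p : menu (Theta p : csp) = top (menu (p : csp)).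
  apply/setP => a; rewrite !inE exE /=.
  by case: ifP => _; rewrite ?andbF // /nilp size_map andbT.
elim: h => [|[M1 a] h IH] /=.
  apply: eq_observable (observable_dep_menu (G := fun N _ => (top N == M)%:R) _).
    by move=> p _; rewrite menuE.
  by move=> N; apply: observable_cst.
pose F (N : {set A}) p :=
  ((top N == M1) && ~~ [exists b, (a < b)%O && (b \in N)])%:R *
  \sum_(u <- step p a) expect (u : csp) (fun v => weight (Theta v : csp) h M).
apply: eq_observable (observable_dep_menu (G := F) _); last first.
  by move=> N; apply/observableZ/observable_step.
move=> p _; rewrite menuE /F; case: (_ == M1); rewrite ?mul0r //= mul1r.
rewrite exE; case: ifP => _; rewrite ?big_nil ?mul0r // mul1r big_map.
by apply: eq_bigr => u _; rewrite expect_Theta.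
Qed.

(* Common properties of [Par] (with L = setT) and [ParL L], stated so that they
   are stable under exchanging the operands. *)
Record synchronises (L : {set A}) (op : term -> term -> term) : Prop := {
  sync_expect : forall p q G, expect (op p q : csp) G =
    expect (p : csp) (fun p' => expect (q : csp) (fun q' => G (op p' q')));
  sync_menu : forall p q, nilp (dash p) -> nilp (dash q) ->
    menu (op p q : csp) =
    [set a | if a \in L then (a \in menu (p : csp)) && (a \in menu (q : csp))
             else (a \in menu (p : csp)) || (a \in menu (q : csp))];
  sync_step : forall p q a G, nilp (dash p) -> nilp (dash q) ->
    \sum_(u <- step (op p q) a) G u =
    if a \in L then \sum_(p' <- step p a) \sum_(q' <- step q a) G (op p' q')
    else \sum_(p' <- step p a) G (op p' q) + \sum_(q' <- step q a) G (op p q') }.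

Lemma synchronises_swap L op :
  synchronises L op -> synchronises L (fun p q => op q p).
Proof.
move=> [hE hM hS]; split=> [p q G|p q hp hq|p q a G hp hq].
- by rewrite hE expect_exchange.
- rewrite hM //; apply/setP => a; rewrite !inE.
  by case: ifP => _; [rewrite andbC | rewrite orbC].
- by rewrite hS //; case: ifP => _; [exact: exchange_big | exact: addrC].
Qed.

Lemma synchronises_Par : synchronises setT (@Par R disp A).
Proof.
split=> [p q G|p q _ _|p q a G _ _]; first exact: expect_par_ptrans.
- by apply/setP => a; rewrite !inE /= /nilp size_allpairs muln_eq0 negb_or.
- by rewrite inE [LHS]big_allpairs_dep.
Qed.

Lemma synchronises_ParL L : synchronises L (@ParL R disp A L).
Proof.
split=> [p q G|p q hp hq|p q a G hp hq]; first exact: expect_par_ptrans.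
- apply/setP => a; rewrite !inE /= hp hq; case: ifP => _.
    by rewrite /nilp size_allpairs muln_eq0 negb_or.
  by rewrite /nilp size_cat !size_map addn_eq0 negb_and.
- rewrite /= hp hq; case: ifP => _; first by rewrite [LHS]big_allpairs_dep.
  by rewrite big_cat !big_map.
Qed.

(** The induction varies [q], which may move too. Moves of [p] fall under [observable_step]; a lone
    move of [q] leaves [p] in place, and the induction hypothesis applies directly. *)
Lemma observable_op L op : synchronises L op -> forall h M q, nilp (dash q) ->
  observable (fun p => weight (op p q : csp) h M).
Proof.
move=> [hE hM hS] h M.
pose m (N N' : {set A}) : {set A} :=
  [set a | if a \in L then (a \in N) && (a \in N') else (a \in N) || (a \in N')].
elim: h => [|[M1 a] h IH] q hq /=.
  apply: eq_observable (observable_dep_menu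
    (G := fun N _ => (m N (menu (q : csp)) == M)%:R) _).
    by move=> p hp; rewrite hM.
  by move=> N; apply: observable_cst.
(* A successor of [q] may be probabilistic, so the induction hypothesis is used under an
   expectation. *)
pose W q p := expect (q : csp) (fun q' => weight (op p q' : csp) h M).
have obsW q' : observable (W q') by apply: observable_expect.
have massE p q' : mass (op p q' : csp) h M = expect (p : csp) (W q') by exact: hE.
pose F (N : {set A}) p := (m N (menu (q : csp)) == M1)%:R *
  (if a \in L then
     \sum_(q' <- step q a) \sum_(p' <- step p a) expect (p' : csp) (W q')
   else \sum_(p' <- step p a) expect (p' : csp) (W q) +
        \sum_(q' <- step q a) W q' p).
apply: eq_observable (observable_dep_menu (G := F) _); last first.
  move=> N; apply: observableZ; case: (a \in L).
    by apply: observable_sum => q' _; apply: observable_step.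
  apply: observableD; first exact: observable_step.
  exact: observable_sum.
move=> p hp; rewrite hM // /F; congr (_ * _); rewrite hS //; case: ifP => _.
  rewrite exchange_big; apply: eq_bigr => q' _; apply: eq_bigr => p' _.
  exact: massE.
congr (_ + _); apply: eq_bigr => u _; first exact: massE.
(* Here [p] has not moved, and its expectation is evaluation at [p]. *)
by rewrite -/(mass _ h M) massE /expect hp.
Qed.

(** * Distribution of weights through contexts *)

Lemma mass_op L op (I : finType) (pi : I -> R) (s q : term) (y : I -> term) :
  synchronises L op ->
  (forall h M, mass (s : csp) h M = \sum_i pi i * mass (y i : csp) h M) ->
  forall h M, mass (op s q : csp) h M = \sum_i pi i * mass (op (y i) q : csp) h M.
Proof.
move=> hop hs h M; rewrite /mass (sync_expect hop).
rewrite (expect_observable (G := fun t => expect (q : csp)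
  (fun q' => weight (op t q' : csp) h M)) hs).
  by apply: eq_bigr => i _; rewrite (sync_expect hop).
by apply: observable_expect => u; apply: observable_op hop _ _ _.
Qed.

Lemma mass_Ext (l : seq (A * term)) h M : mass (Ext l : csp) h M =
  if h is (M1, a) :: h' then
    ([set b in unzip1 l] == M1)%:R *
      \sum_(e <- l | e.1 == a) mass (e.2 : csp) h' M
  else ([set b in unzip1 l] == M)%:R.
Proof.
have menuE : menu (Ext l : csp) = [set b in unzip1 l].
  apply/setP => b; rewrite !inE /= /nilp size_map size_filter -lt0n -has_count.
  by rewrite -[RHS]has_pred1 has_map.
rewrite /mass {1}/expect.
by case: h => [|[M1 a] h] /=; rewrite menuE // big_map big_filter.
Qed.

Lemma mass_fill (C : context R A) (I : finType) (pi : I -> R) (x : I -> term) :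
  \sum_i pi i = 1 -> forall h M,
  mass (fill C (prob_choice pi x) : csp) h M =
  \sum_i pi i * mass (fill C (x i) : csp) h M.
Proof.
move=> pi1.
(* Spreads the contributions of hole-free parts of the context over the choice. *)
have mix (c : R) : c = \sum_i pi i * c by rewrite -mulr_suml pi1 mul1r.
elim: C => [|l1 a C IH l2|l1 r C IH l2|C IH|C IH q|q C IH|L C IH q|L q C IH] /= h M.
- rewrite /mass expect_PChoice ?big_image //.
  (* An empty [I] would give [pi] the sum 0 instead of 1. *)
  apply/eqP => im0; have : #|I| = 0%N by rewrite -(size_image (fun i => (pi i, x i))) im0.
  by move=> /card0_eq I0; move/eqP: pi1; rewrite big_pred0 // eq_sym oner_eq0.
- case: h => [|[M1 b] h].
    rewrite mass_Ext [LHS]mix; apply: eq_bigr => i _.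
    by rewrite mass_Ext /unzip1 !map_cat.
  rewrite mass_Ext; under [RHS]eq_bigr do rewrite mass_Ext /unzip1 map_cat /= mulrCA.
  rewrite -mulr_sumr /unzip1 map_cat /=; congr (_ * _).
  under [RHS]eq_bigr do rewrite big_cat big_cons /=.
  (* If [a == b], induction handles the summand with the hole; all other summands are constant in
     [i]. *)
  rewrite big_cat big_cons /=; case: ifP => _.
    under [RHS]eq_bigr do rewrite !mulrDr.
    by rewrite !big_split /= -!mix IH.
  under [RHS]eq_bigr do rewrite !mulrDr.
  by rewrite !big_split /= -!mix.
- have neq0 p : l1 ++ (r, p) :: l2 != [::] by case: l1.
  rewrite /mass expect_PChoice //.
  under [RHS]eq_bigr do
    rewrite expect_PChoice // big_cat big_cons /= !mulrDr (mulrCA _ r).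
  by rewrite !big_split /= -!mix -mulr_sumr -IH big_cat big_cons.
- rewrite /mass expect_Theta (expect_observable IH (observable_Theta h M)).
  by apply: eq_bigr => i _; rewrite expect_Theta.
- exact: mass_op synchronises_Par IH h M.
- exact: mass_op (synchronises_swap synchronises_Par) IH h M.
- exact: mass_op (synchronises_ParL L) IH h M.
- exact: mass_op (synchronises_swap (synchronises_ParL L)) IH h M.
Qed.

End Contexts.

Theorem theorem3 (R : realType) (disp : Order.disp_t) (A : finPOrderType disp)
    (C : context R A) (I : finType) (pi : I -> R) (x : I -> term R A)
    (x_csp : forall i, csp_process (x i))
    (pi_range : forall i, 0 < pi i <= 1)
    (pi_sum : \sum_i pi i = 1)
    (C_csp : csp_process (fill C (prob_choice pi x))) :
  ready_trace_equiv (process_of (fill C (prob_choice pi x)))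
                    (process_of (prob_choice pi (fun i => fill C (x i)))).
Proof.
have [pts1 pts2] := fill_is_pts C_csp.
apply: mass_ready_trace_equiv => [||h M] /=.
- by right; apply: pts_deterministic pts1.
- by right; apply: pts_deterministic pts2.
- by rewrite (mass_fill C x pi_sum) (mass_fill Hole _ pi_sum).
Qed.
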